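(* Let $G$ be a connected graph with at least two vertices, and let $f$ be a harmonic eigenfunction for $\lambda_1$, the second smallest eigenvalue of the normalized Laplacian matrix $\mathcal{L}(G)$. Then exactly one of the following two cases occurs. Case 1. There is no mixed block. In this case, there is a unique point of articulation $z$ having $f(z)=0$ and a neighbor $w$ with $f(w)\neq 0$. Each block (with the exception of the vertex $z$) is either a positive block, or a negative block, or a zero block. Let $P$ be a pure path which starts at $z$. Then the values of $f$ at the points of articulation of $P$ (with the exception of $z$), taken in the order in which they appear along $P$, form either an increasing, or a decreasing, or a zero sequence. Every path containing both positive and negative vertices passes through $z$. Case 2. There is a unique block $B_0$ which is mixed. In this case, each remaining block is positive, negative or null (zero). Moreover, each pure path $P$ starting in $B_0$ and containing only one vertex $v\in B_0$ has the property that the values of $f$ at the points of articulation contained in $P$, taken in the order in which they appear along $P$ starting from $v$, form either an increasing, or a decreasing, or a zero sequence according to whether $f(v)>0$, $f(v)<0$ or $f(v)=0$. In the last case $f\equiv 0$ along the path.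
   Context: Graphs are finite, simple and undirected, without isolated vertices; $d_v$ is the degree of $v$. The normalized Laplacian matrix of a graph $G$ on $n$ vertices is the $n\times n$ matrix $\mathcal{L}(G)$ with entries $\mathcal{L}(u,u)=1$, $\mathcal{L}(u,v)=-1/\sqrt{d_u d_v}$ if $u,v$ are adjacent, and $0$ otherwise. Its eigenvalues are denoted $0=\lambda_0\le\lambda_1\le\dots\le\lambda_{n-1}$. An eigenfunction of $\lambda$ is a nonzero real function $g$ on the vertices (viewed as a column vector) with $\mathcal{L}g=\lambda g$; the corresponding harmonic eigenfunction of $\lambda$ is $f=D^{-1/2}g$, where $D$ is the diagonal matrix of degrees. A point of articulation is a cut vertex of $G$. A block of $G$ is a maximal induced connected subgraph not containing a point of articulation (of itself). A path is pure if it contains at most two points of articulation (of $G$) of each block. A vertex $v$ is positive (negative) if $f(v)>0$ ($f(v)<0$). A block is mixed if it contains both positive and negative vertices; it is a positive (resp. negative, zero/null) block if $f$ is positive (resp. negative, zero) at all its vertices; ''with the exception of the vertex $z$'' means that the vertex $z$ is disregarded if it belongs to the block. *)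

(* Defs.v *)
(* A graph is a symmetric irreflexive relation [e] on a finType [T]; *)
(* the reals are an arbitrary real closed field. *)
From mathcomp Require Import all_boot all_order all_algebra.

Set Implicit Arguments.
Unset Strict Implicit.
Unset Printing Implicit Defensive.

Import Order.TTheory GRing.Theory Num.Theory.
Local Open Scope ring_scope.

Section Graph.
Variables (T : finType) (e : rel T).

Definition deg (v : T) : nat := #|[set u | e v u]|.

Definition induced (S : {set T}) : rel T :=
  [rel x y | [&& x \in S, y \in S & e x y]].

Definition connected_in (S : {set T}) : bool :=
  (S != set0) && [forall x in S, forall y in S, connect (induced S) x y].

(* [v] separates two other vertices of the same component of the subgraph *)
(* induced by [S].                                                        *)
Definition cutvertex (S : {set T}) (v : T) : bool :=
  (v \in S) &&
  [exists x in S :\ v, exists y in S :\ v,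
     connect (induced S) x y && ~~ connect (induced (S :\ v)) x y].

Definition articulation (v : T) : bool := cutvertex [set: T] v.

(* Induced subgraphs are identified with their vertex sets. *)
Definition block (B : {set T}) : bool :=
  maxset [pred S : {set T} |
            connected_in S && [forall v in S, ~~ cutvertex S v]] B.

(* The path with vertices [x :: p], in this order; vertices are distinct. *)
Definition gpath (x : T) (p : seq T) : bool := path e x p && uniq (x :: p).

Definition pure_path (x : T) (p : seq T) : Prop :=
  gpath x p /\
  forall B : {set T}, block B ->
    (#|[set v in B | articulation v && (v \in x :: p)]| <= 2)%N.

End Graph.

Section Spectrum.
Variables (R : rcfType) (T : finType) (e : rel T).

Definition nlap_entry (u v : T) : R :=
  if u == v then 1
  else if e u v then - (Num.sqrt ((deg e u)%:R * (deg e v)%:R))^-1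
  else 0.

Definition nlap : 'M[R]_#|T| :=
  \matrix_(i, j) nlap_entry (enum_val i) (enum_val j).

Definition colvec (g : T -> R) : 'cV[R]_#|T| := \col_i g (enum_val i).

(* [s] lists all eigenvalues of [A], with multiplicity, in nondecreasing order *)
Definition is_spectrum (n : nat) (A : 'M[R]_n) (s : seq R) : Prop :=
  sorted <=%R s /\ char_poly A = \prod_(a <- s) ('X - a%:P).

Definition is_lambda (k : nat) (lam : R) : Prop :=
  exists s : seq R, [/\ is_spectrum nlap s, (k < size s)%N & lam = s`_k].

Definition eigenfunction (lam : R) (g : T -> R) : Prop :=
  (exists v, g v != 0) /\ nlap *m colvec g = lam *: colvec g.

Definition harmonic_eigenfunction (lam : R) (f : T -> R) : Prop :=
  exists2 g, eigenfunction lam g &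
    forall v, f v = (Num.sqrt (deg e v)%:R)^-1 * g v.

End Spectrum.

Section Sign.
Variables (R : rcfType) (T : finType) (e : rel T) (f : T -> R).

Definition pos_on (S : {set T}) : Prop := forall v, v \in S -> 0 < f v.
Definition neg_on (S : {set T}) : Prop := forall v, v \in S -> f v < 0.
Definition zero_on (S : {set T}) : Prop := forall v, v \in S -> f v = 0.

Definition mixed_block (B : {set T}) : Prop :=
  [/\ block e B, exists2 v, v \in B & 0 < f v & exists2 v, v \in B & f v < 0].

(* Values of [f] at the points of articulation of the graph listed in [p]. *)
Definition art_values (p : seq T) : seq R :=
  [seq f v | v <- p & articulation e v].

Definition increasing_seq (s : seq R) : Prop := sorted <%R s.
Definition decreasing_seq (s : seq R) : Prop := sorted >%R s.
Definition zero_seq (s : seq R) : Prop := {in s, forall a, a = 0}.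

Definition zero_frontier (z : T) : Prop :=
  [/\ articulation e z, f z = 0 & exists2 w, e z w & f w != 0].

Definition case1_conclusion : Prop :=
  exists z : T,
    unique zero_frontier z /\
    [/\ forall B, block e B ->
          [\/ pos_on (B :\ z), neg_on (B :\ z) | zero_on (B :\ z)],
        forall p, pure_path e z p ->
          [\/ increasing_seq (art_values p), decreasing_seq (art_values p)
            | zero_seq (art_values p)]
      & forall x p, gpath e x p ->
          (exists2 v, v \in x :: p & 0 < f v) ->
          (exists2 v, v \in x :: p & f v < 0) -> z \in x :: p].

Definition case2_conclusion (B0 : {set T}) : Prop :=
  (forall B, block e B -> B != B0 -> [\/ pos_on B, neg_on B | zero_on B]) /\
  (forall v p, pure_path e v p -> v \in B0 -> {in p, forall u, u \notin B0} ->
     [/\ 0 < f v -> increasing_seq (art_values (v :: p)),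
         f v < 0 -> decreasing_seq (art_values (v :: p))
       & f v = 0 -> zero_seq (art_values (v :: p)) /\
                    {in v :: p, forall u, f u = 0}]).

End Sign.

(* Main.v *)
Require Import Defs.
From mathcomp Require Import all_boot all_order all_algebra.
From mathcomp Require Import complex ring.

Set Implicit Arguments.
Unset Strict Implicit.
Unset Printing Implicit Defensive.
Import Order.TTheory GRing.Theory Num.Theory.
Local Open Scope ring_scope.

(** Write the eigenvalue equation as [M f = 0], where
    [(M y) v = \sum_(u ~ v) (y v - y u) - lam * deg v * y v]
    ([shifted_lap]).  Everything rests on two properties of [M].

    (a) Variational.  As [lam] is the second smallest eigenvalue and the kernel
    of the Laplacian consists of the constants, [lam > 0] and the quadratic form
    of [M] is nonnegative on the functions of degree-weighted mean zero; if it
    is nonpositive at one of them, that function is in the kernel of [M]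
    ([rayleigh_lambda1]).

    (b) Maximum principle.  Let [w] be nonnegative on a component of [G - z] and
    at [z], with [M w = 0] on the component.  If [w] vanishes at one vertex of
    the component, it vanishes on all of it and at [z] ([strong_min_principle]).

    The key consequence is [two_negative_components].  Let [f z >= 0] and let
    two components of [G - z] both contain negative vertices.  Restrict
    [min(f, 0)] to each of the two, and take the combination of mean zero.  The
    form is nonpositive there, so by (a) the combination solves [M p = 0], and
    comparing it with [f] through (b) forces [f z = 0] and [f < 0] on both
    components.  Hence, up to replacing [f] by [-f]:
    if [f z > 0], all components of [G - z] but at most one are positive
    ([component_positive_of_sibling]); if [f z = 0] and a component has both
    signs, then [f] vanishes on the others ([mixed_component_exclusive]); if
    [f z = 0] and two components have opposite signs, then every component is
    positive, negative or zero ([component_positive]).  Moreover, on a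
    positive component of [G - x] every value exceeds [f x], because
    [\sum_(u ~ v) (f v - f u) = lam * deg v * f v > 0] excludes a minimum there
    ([increase_past]).

    The rest is block combinatorics.  A block cannot be enlarged by a path with
    both ends in it, so a path which leaves a block [B] at [z] cannot return to
    [B] without passing through [z] ([block_ear]).  Therefore every vertex
    outside [B] is cut off from [B] by a single vertex of [B] ([block_gate]), and
    each articulation point of a pure path which starts at an articulation
    point separates the start from the later articulation points
    ([pure_path_separates]); otherwise it would share a block with two other
    articulation points of the path.

    If there is no mixed block, positive and negative vertices are never
    adjacent, so some zero vertex [z] has neighbours of both signs, and they lie
    in different components of [G - z].  If [B0] is a mixed block, any vertex
    that a cut vertex [z] separates from [B0] has the sign of [f z]; this gives
    the uniqueness of [B0] and the signs of the other blocks.  In both cases,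
    along a pure path on which [f] is positive, [increase_past] applies at each
    articulation point. *)

(** * Rayleigh quotients and the second eigenvalue *)

Section Spectral.
Variable R : rcfType.
Local Notation C := (R[i]%C).
Local Notation cplx := (map_mx (real_complex R)).

Lemma conj_cplx m n (M : 'M[R]_(m, n)) : map_mx Num.conj (cplx M) = cplx M.
Proof.
apply/matrixP => i j; rewrite !mxE; apply/CrealP.
by rewrite complex_real.
Qed.

Lemma char_poly_similar n (P D : 'M[C]_n) : P \in unitmx ->
  char_poly (invmx P *m D *m P) = char_poly D.
Proof.
move=> Pu; rewrite /char_poly.
have Pu' : map_mx polyC P \in unitmx by rewrite map_unitmx.
have -> : char_poly_mx (invmx P *m D *m P) =
   invmx (map_mx polyC P) *m char_poly_mx D *m map_mx polyC P.
  rewrite /char_poly_mx mulmxBr mulmxBl !map_mxM map_invmx; congr (_ - _).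
  by rewrite mul_mx_scalar -scalemxAl mulVmx ?scalemx1.
by rewrite !det_mulmx mulrAC -det_mulmx mulVmx // det1 mul1r.
Qed.

(** Diagonalization takes place over the algebraically closed field [R[i]]; the
    eigenvalues found there are the roots of the real characteristic
    polynomial, so they can be listed by [s]. *)
Lemma symmetric_unitary_diag n (A : 'M[R]_n) (s : seq R) :
  A^T = A -> is_spectrum A s ->
  exists P : 'M[C]_n, exists d : 'I_n -> R,
    [/\ P \is unitarymx, P *m cplx A = diag_mx (\row_i (d i)%:C%C) *m P
      & perm_eq (codom d) s].
Proof.
move=> symA [_ chA].
have hA : cplx A \is hermsymmx.
  apply: realsym_hermsym.
    apply/is_hermitianmxP; rewrite expr0 scale1r.
    by apply/matrixP => i j; rewrite !mxE -[in LHS]symA mxE.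
  by apply/mxOverP => i j; rewrite mxE complex_real.
have /orthomx_spectralP eqA := hermitian_normalmx hA.
have := hermitian_spectral_diag_real hA.
have := spectral_unitarymx (cplx A).
set P := spectralmx _ in eqA *; set D := spectral_diag _ in eqA *.
clearbody P D => Pu /mxOverP Dr; pose d i := complex.Re (D 0 i).
have dE : D = \row_i (d i)%:C%C.
  by apply/rowP => i; rewrite mxE /d RRe_real.
have Pun := unitarymx_unit Pu.
exists P, d; split; first exact: Pu.
  by rewrite eqA !mulmxA (mulmxV Pun) mul1mx dE.
have: char_poly (cplx A) = \prod_(a <- map (fun i => (d i)%:C%C) (enum 'I_n)) ('X - a%:P).
  rewrite eqA char_poly_similar // char_poly_trig; last exact: diag_mx_is_trig.
  rewrite big_map big_enum /=; apply: eq_bigr => i _.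
  by rewrite dE !mxE eqxx mulr1n.
rewrite -map_char_poly chA rmorph_prod /=.
under eq_bigr do rewrite map_polyXsubC.
rewrite -(big_map (real_complex R) xpredT (fun a => 'X - a%:P)) => /esym.
move/prod_XsubC_eq; rewrite (map_comp (real_complex R) d) => /(perm_map_inj (@complexI R)).
by rewrite codomE.
Qed.

Section Diagonalized.
Variables (n : nat) (A : 'M[R]_n) (P : 'M[C]_n) (d : 'I_n -> R).
Hypothesis Pu : P \is unitarymx.
Hypothesis PA : P *m cplx A = diag_mx (\row_i (d i)%:C%C) *m P.

(* Coordinates of a real vector in the unitary eigenbasis. *)
Let coord (g : 'cV[R]_n) := P *m cplx g.

Lemma unitary_adjK : map_mx Num.conj P^T *m P = 1%:M.
Proof. by rewrite -(invmx_unitary Pu) mulVmx // unitarymx_unit. Qed.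

Lemma coord_dot (g h : 'cV[R]_n) :
  \sum_i (coord g i 0)^* * coord h i 0 = ((g^T *m h) 0 0)%:C%C.
Proof.
have -> : ((g^T *m h) 0 0)%:C%C = (map_mx Num.conj (coord g)^T *m coord h) 0 0.
  rewrite trmx_mul map_mxM map_trmx conj_cplx mulmxA -(mulmxA _ _ P).
  by rewrite unitary_adjK mulmx1 -map_mxM [RHS]mxE; reflexivity.
by rewrite mxE; apply: eq_bigr => i _; rewrite !mxE.
Qed.

Lemma coord_mul (g : 'cV[R]_n) i : coord (A *m g) i 0 = (d i)%:C%C * coord g i 0.
Proof. by rewrite /coord map_mxM mulmxA PA -mulmxA mul_diag_mx !mxE. Qed.

Lemma coord_inj (g : 'cV[R]_n) : (forall i, coord g i 0 = 0) -> g = 0.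
Proof.
move=> g0; have /(congr1 (mulmx (map_mx Num.conj P^T))) : coord g = 0.
  by apply/colP => i; rewrite g0 mxE.
rewrite mulmxA unitary_adjK mul1mx mulmx0 => /matrixP eq0.
by apply/matrixP => i j; apply: (@complexI R); have := eq0 i j; rewrite !mxE.
Qed.

End Diagonalized.

(** A root of the characteristic polynomial has an eigenvector over [R] itself,
    on which the form equals the eigenvalue times a sum of squares. *)
Lemma psd_eigenvalue_ge0 n (A : 'M[R]_n) a :
  (forall x : 'cV[R]_n, 0 <= (x^T *m A *m x) 0 0) -> root (char_poly A) a -> 0 <= a.
Proof.
move=> psdA; rewrite -eigenvalue_root_char => /eigenvalueP[v vA v0].
have := psdA v^T; rewrite trmxK vA -scalemxAl mxE.
suff v_gt0 : 0 < (v *m v^T) 0 0 by rewrite pmulr_lge0.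
have v_sum : (v *m v^T) 0 0 = \sum_j v 0 j ^+ 2.
  by rewrite mxE; apply: eq_bigr => j _; rewrite mxE.
rewrite v_sum lt0r sumr_ge0 ?andbT; last by move=> j _; exact: sqr_ge0.
apply: contraNneq v0 => /eqP; rewrite psumr_eq0; last by move=> j _; exact: sqr_ge0.
move=> /allP v0; apply/eqP/rowP => j; rewrite mxE; apply/eqP.
by rewrite -sqrf_eq0; exact: (implyP (v0 j (mem_index_enum j)) isT).
Qed.

Lemma second_smallest_count (s : seq R) : sorted <=%R s -> (1 < size s)%N ->
  (count (fun a : R => (a < s`_1)%R) s <= 1)%N.
Proof.
case: s => [|a [|b t]] //= /andP[ab bt] _; rewrite ltxx add0n.
suff -> : count (fun c : R => c < b) t = 0%N by rewrite addn0; case: (_ < _).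
apply/eqP; rewrite -leqn0 leqNgt -has_count; apply/hasPn => c ct.
by rewrite -leNgt; apply: (allP (order_path_min le_trans bt)).
Qed.

(** For a positive semidefinite matrix with one-dimensional kernel spanned by
    [k], the eigenvalue 0 is simple, so all eigenvalues but one are at least
    [s`_1 > 0].  The coordinate of [g] along the exceptional one vanishes when
    [g] is orthogonal to [k]; the remaining terms of the form of [A - s`_1] are
    nonnegative, so if their sum is not positive they all vanish. *)
Lemma second_eigenvalue_rayleigh n (A : 'M[R]_n) (s : seq R) (k : 'cV[R]_n) :
  A^T = A -> is_spectrum A s -> (1 < size s)%N ->
  (forall x : 'cV[R]_n, 0 <= (x^T *m A *m x) 0 0) ->
  k != 0 -> A *m k = 0 -> (forall x, A *m x = 0 -> exists c, x = c *: k) ->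
  0 < s`_1 /\
  forall g : 'cV[R]_n, k^T *m g = 0 ->
    (g^T *m A *m g) 0 0 <= s`_1 * (g^T *m g) 0 0 -> A *m g = s`_1 *: g.
Proof.
move=> symA specA s_gt1 psdA k0 Ak kerA.
have [P [d [Pu PA ds]]] := symmetric_unitary_diag symA specA.
have card_d (Q : pred R) : #|[pred i | Q (d i)]| = count Q s.
  rewrite -(permP ds) codomE count_map -size_filter cardE enumT /enum_mem.
  by congr size; exact: eq_filter.
have s_ge0 a : a \in s -> 0 <= a.
  case: specA => _ chA a_s; apply: (psd_eigenvalue_ge0 psdA).
  by rewrite chA root_prod_XsubC.
(* An eigenvector for 0 over [R[i]] is a multiple of [k]: kernels commute with
   the extension of scalars. *)
have kerP i : d i = 0 -> exists c, row i P = c *: cplx k^T.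
  move=> di0; apply/sub_rVP.
  have : (row i P <= kermx (cplx A))%MS.
    by apply/sub_kermxP; rewrite -row_mul PA row_mul row_diag_mx mxE di0 scale0r mul0mx.
  move/submx_trans; apply.
  rewrite -map_kermx map_submx; apply/row_subP => j.
  apply/sub_rVP; have [|c ec] := kerA (row j (kermx A))^T.
    by rewrite -[X in X *m _]symA -trmx_mul -row_mul mulmx_ker row0 trmx0.
  by exists c; rewrite -[LHS]trmxK ec linearZ.
(* Two distinct rows of [P] are orthogonal, so cannot both be multiples of [k]. *)
have d0_inj i j : d i = 0 -> d j = 0 -> i = j.
  move=> /kerP[a Pa] /kerP[b Pb]; apply/eqP; apply/negPn/negP => ij.
  pose kk := \sum_l (cplx k) l 0 * ((cplx k) l 0)^*.
  have dot i' j' a' b' : row i' P = a' *: cplx k^T -> row j' P = b' *: cplx k^T ->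
     (i' == j')%:R = a' * b'^* * kk.
    move=> /rowP ei /rowP ej; have /unitarymxP/matrixP/(_ i' j') := Pu.
    rewrite !mxE => <-; rewrite mulr_sumr; apply: eq_bigr => l _.
    have := ei l; have := ej l; rewrite !mxE => -> ->.
    by rewrite rmorphM mulrACA.
  have := dot _ _ _ _ Pa Pa; have := dot _ _ _ _ Pb Pb; have := dot _ _ _ _ Pa Pb.
  rewrite !eqxx (negPf ij) => /esym/eqP.
  rewrite !mulf_eq0 => /orP[/orP[/eqP->|/eqP->]|/eqP->]; rewrite ?(mulr0, mul0r) => /eqP;
    by rewrite ?oner_eq0 // => _ /eqP; rewrite oner_eq0.
have s1_in : s`_1 \in s by rewrite mem_nth.
have s1_gt0 : 0 < s`_1.
  rewrite lt0r s_ge0 // andbT; apply/negP => /eqP s1_0.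
  have : (1 < #|[pred i | d i == 0%R]|)%N.
    rewrite (card_d (pred1 0)); case: specA => srt _.
    case: s srt s_gt1 s1_0 s_ge0 {ds card_d s1_in} => [|a [|b t]] //= /andP[ab _] _ b0 s_ge0.
    have /eqP -> : a == 0 by rewrite eq_le s_ge0 ?inE ?eqxx // andbT -b0.
    by rewrite b0 !eqxx.
  by case/card_gt1P => i [j [/eqP di /eqP dj /eqP ij]]; apply: ij; apply: d0_inj.
split=> // g kg rq.
(* [i0] is the index of the eigenvalue 0. *)
have [i0 ki0] : exists i, (P *m cplx k) i 0 != 0.
  apply/existsP; apply: contraNT k0; rewrite negb_exists => /forallP Pk0.
  by apply/eqP/(coord_inj Pu) => i; apply/eqP; have := Pk0 i; rewrite negbK.
have dk i : (d i)%:C%C * (P *m cplx k) i 0 = 0.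
  by rewrite -(coord_mul PA) Ak map_mx0 mulmx0 mxE.
have di0 : d i0 = 0.
  have /eqP := dk i0; rewrite mulf_eq0 (negPf ki0) orbF => /eqP.
  exact: (@complexI R _ 0).
have d_ge i : i != i0 -> s`_1 <= d i.
  rewrite leNgt; apply: contra => di_lt; apply/eqP.
  have : (#|[pred i | (d i < s`_1)%R]| <= 1)%N.
    by rewrite (card_d (fun a : R => a < s`_1)); case: specA => srt _; exact: second_smallest_count.
  by move/card_le1_eqP; apply; rewrite inE // di0.
have gi0 : (P *m cplx g) i0 0 = 0.
  have := coord_dot Pu k g; rewrite kg mxE (bigD1 i0) //= big1 ?addr0.
    by move/eqP; rewrite mulf_eq0 conjC_eq0 (negPf ki0) => /eqP.
  move=> i ii0; have /eqP := dk i; rewrite mulf_eq0 => /orP[/eqP di|/eqP ->].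
    have := d_ge i ii0; have /= -> := (@complexI R _ 0 di).
    by rewrite leNgt s1_gt0.
  by rewrite conjC0 mul0r.
have sum_le0 : \sum_i (d i - s`_1)%:C%C * ((P *m cplx g) i 0)^* * (P *m cplx g) i 0 <= 0.
  have <- : (((g^T *m (A *m g)) 0 0)%:C%C - (s`_1)%:C%C * ((g^T *m g) 0 0)%:C%C) =
     \sum_i (d i - s`_1)%:C%C * ((P *m cplx g) i 0)^* * (P *m cplx g) i 0.
    rewrite -!(coord_dot Pu) mulr_sumr -sumrB; apply: eq_bigr => i _.
    by rewrite (coord_mul PA) rmorphB /=; ring.
  by rewrite -rmorphM -rmorphB /= -(rmorph0 (real_complex R)) lecR subr_le0 mulmxA.
have term_ge0 i : 0 <= (d i - s`_1)%:C%C * ((P *m cplx g) i 0)^* * (P *m cplx g) i 0.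
  have [->|ii0] := eqVneq i i0; first by rewrite gi0 mulr0.
  rewrite -mulrA mulr_ge0 //; first by rewrite ler0c subr_ge0 d_ge.
  by rewrite mulrC mul_conjC_ge0.
have sum0 : \sum_i (d i - s`_1)%:C%C * ((P *m cplx g) i 0)^* * (P *m cplx g) i 0 == 0.
  by rewrite eq_le sum_le0 sumr_ge0.
move: sum0; rewrite psumr_eq0 // => /allP term0.
apply/eqP; rewrite -subr_eq0; apply/eqP; apply: (coord_inj Pu) => i.
have := implyP (term0 i (mem_index_enum i)) isT; rewrite !mulf_eq0 conjC_eq0 -orbA orbb => ti.
have -> : (P *m cplx (A *m g - s`_1 *: g)) i 0 = (d i - s`_1)%:C%C * (P *m cplx g) i 0.
  rewrite map_mxB mulmxBr mxE (coord_mul PA) map_mxZ -scalemxAr !mxE.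
  by rewrite rmorphB mulrBl.
by apply/eqP; rewrite mulf_eq0.
Qed.

End Spectral.

(** * Connection avoiding a vertex *)

Section Graph.
Variables (T : finType) (e : rel T).
Hypothesis e_sym : symmetric e.
Hypothesis e_conn : connected_in e [set: T].

Lemma connectT x y : connect e x y.
Proof.
have /andP[_ /forallP/(_ x)/implyP/(_ (in_setT x))/forallP/(_ y)/implyP/(_ (in_setT y))] := e_conn.
by apply: connect_sub => u v /and3P[_ _ /connect1].
Qed.

Lemma closed_total (P : T -> Prop) x y :
  (forall u v, P u -> e u v -> P v) -> P x -> P y.
Proof.
move=> closedP Px; have /connectP[p ep ->] := connectT x y.
elim: p x Px ep => //= u p IHp x Px /andP[exu]; apply: IHp.
exact: closedP exu.
Qed.

(** For [x] and [y] different from [z], they are in the same component of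
    [G - z]; so a component of [G - z] appears below as [avoid z c] for some
    [c != z].  The vertex [z] is joined only to itself. *)
Definition avoid (z : T) : rel T := connect (induced e ([set: T] :\ z)).

Lemma induced_sym S : symmetric (induced e S).
Proof. by move=> x y; rewrite /induced /= e_sym andbCA. Qed.

Lemma avoid_sym z : symmetric (avoid z).
Proof. exact/sym_connect_sym/induced_sym. Qed.

Lemma avoid_refl z : reflexive (avoid z).
Proof. exact: connect0. Qed.

Lemma avoid_trans z : transitive (avoid z).
Proof. exact: connect_trans. Qed.

Lemma avoid_edge z x y : x != z -> y != z -> e x y -> avoid z x y.
Proof. by move=> xz yz exy; apply: connect1; rewrite /induced /= !inE xz yz. Qed.

Lemma avoid_ind z (P : T -> Prop) x y :
  (forall u v, v != z -> P u -> e u v -> P v) -> avoid z x y -> P x -> P y.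
Proof.
move=> stepP /connectP[p + ->]; elim: p x => //= u p IHp x /andP[/and3P[_ + exu] ep] Px.
by rewrite !inE andbT => uz; apply: IHp ep _; apply: stepP exu.
Qed.

Lemma avoid_neq z x y : avoid z x y -> x != z -> y != z.
Proof. by move=> xy; apply: (avoid_ind (P := fun u => u != z)) xy. Qed.

Lemma avoid_path z x p : path e x p -> z \notin x :: p -> avoid z x (last x p).
Proof.
elim: p x => [|u p IHp] x /=; first by rewrite /avoid connect0.
case/andP=> exu ep; rewrite in_cons negb_or => /andP[zx zp].
apply: (@avoid_trans _ u); last exact: IHp.
by move: zp; rewrite in_cons negb_or => /andP[zu _]; apply: avoid_edge; rewrite 1?eq_sym.
Qed.

Lemma avoid_mem z x p y : path e x p -> z \notin x :: p -> y \in x :: p -> avoid z x y.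
Proof.
move=> ep zp yp; case/splitPl: yp ep zp => p1 p2 <-.
rewrite cat_path -cat_cons mem_cat negb_or => /andP[ep _] /andP[zp _].
exact: avoid_path.
Qed.

(** * Blocks *)

Section Blocks.
Local Open Scope nat_scope.

Lemma sub_induced (S S' : {set T}) x y : S \subset S' ->
  connect (induced e S) x y -> connect (induced e S') x y.
Proof.
move=> /subsetP sSS'; apply: connect_sub => u v /and3P[uS vS euv].
by apply: connect1; rewrite /induced /= !sSS' // euv.
Qed.

Lemma induced_path (S : {set T}) x p :
  path e x p -> {subset x :: p <= S} -> connect (induced e S) x (last x p).
Proof.
elim: p x => [|u p IHp] x /=; first by rewrite connect0.
case/andP=> exu ep sub.
have uS : u \in S by apply: sub; rewrite !inE eqxx orbT.
apply: (@connect_trans _ _ u); last by apply: IHp => // v vp; apply: sub; rewrite in_cons vp orbT.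
by apply: connect1; rewrite /induced /= uS exu (sub x) // mem_head.
Qed.

Definition biconnected (S : {set T}) : bool :=
  connected_in e S && [forall v in S, ~~ cutvertex e S v].

Lemma connected_inP (S : {set T}) :
  reflect (S != set0 /\ {in S &, forall x y, connect (induced e S) x y}) (connected_in e S).
Proof.
apply: (iffP andP) => -[S0 conS]; split=> //.
  by move=> x y xS yS; exact: (forall_inP (forall_inP conS x xS) y yS).
by apply/forall_inP => x xS; apply/forall_inP => y yS; exact: conS.
Qed.

(** Deleting any [w] is allowed, also outside [S]: then nothing is removed.
    This is the form in which biconnectedness is used and established. *)
Lemma biconnectedP (S : {set T}) :
  reflect [/\ S != set0, {in S &, forall x y, connect (induced e S) x y}
     & forall w, {in S :\ w &, forall x y, connect (induced e (S :\ w)) x y}]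
  (biconnected S).
Proof.
apply: (iffP andP) => [[/connected_inP[S0 conS] /forall_inP ncut]|[S0 conS conSw]].
  split=> // w x y xS yS.
  have [wS|wS] := boolP (w \in S); last first.
    have -> : S :\ w = S by apply/setDidPl; rewrite disjoint_sym disjoints1.
    by apply: conS; [case/setD1P: xS | case/setD1P: yS].
  have := ncut w wS; rewrite /cutvertex wS /= negb_exists_in.
  move/forall_inP/(_ x xS); rewrite negb_exists_in => /forall_inP/(_ y yS).
  by rewrite negb_and negbK conS //; [case/setD1P: xS | case/setD1P: yS].
split; first exact/connected_inP.
apply/forall_inP => w wS; rewrite /cutvertex wS /= negb_exists_in.
apply/forall_inP => x xS; rewrite negb_exists_in; apply/forall_inP => y yS.
by rewrite negb_and negbK conSw ?orbT.
Qed.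

Lemma blockP (B : {set T}) :
  reflect (biconnected B /\ forall S : {set T}, biconnected S -> B \subset S -> S = B)
    (block e B).
Proof. exact: maxsetP. Qed.

Lemma block_avoid B z x y : block e B -> x \in B -> y \in B -> x != z -> y != z ->
  avoid z x y.
Proof.
move=> /blockP[/biconnectedP[_ _ conBw] _] xB yB xz yz.
by apply: sub_induced (conBw z x y _ _); rewrite ?inE ?xz ?yz // setSD ?subsetT.
Qed.

Lemma edge_block x y : e x y -> exists B, [/\ block e B, x \in B & y \in B].
Proof.
move=> exy; have bxy : biconnected [set x; y].
  apply/biconnectedP; split; first by apply/set0Pn; exists x; rewrite set21.
    have cxy : connect (induced e [set x; y]) x y.
      by apply: connect1; rewrite /induced /= set21 set22.
    have cyx : connect (induced e [set x; y]) y x.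
      by apply: connect1; rewrite /induced /= set21 set22 e_sym.
    by move=> u v /set2P[]-> /set2P[]->; rewrite ?connect0.
  move=> w u v /setD1P[uw u2] /setD1P[vw v2].
  have [->|uv] := eqVneq u v; first exact: connect0.
  have inS t : t \in [set x; y] -> t != w -> t \in [set x; y] :\ w by rewrite !inE => -> ->.
  apply: connect1; rewrite /induced /= !inS //.
  case/set2P: u2 v2 uv => -> /set2P[] ->; rewrite ?eqxx //.
  by rewrite e_sym.
have [B /maxsetP[bB maxB] sub] := maxset_exists bxy.
exists B; split; first exact/blockP.
  by apply: (subsetP sub); rewrite set21.
by apply: (subsetP sub); rewrite set22.
Qed.

Lemma first_hit (B : {set T}) x p :
  path e x p -> x \notin B -> last x p \in B ->
  exists q y, [/\ path e x q, {in x :: q, forall v, v \notin B}, e (last x q) y,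
                  y \in B & y \in p].
Proof.
elim: p x => [|u p IHp] x /= => [_ /negPf-> //|/andP[exu ep] xB lB].
have [uB|uB] := boolP (u \in B).
  by exists [::], u; split; rewrite ?mem_head // => v; rewrite inE => /eqP->.
have [q [y [eq qB ey yB yp]]] := IHp u ep uB lB.
exists (u :: q), y; split=> //=; rewrite ?exu //.
  by move=> v; rewrite in_cons => /orP[/eqP->|/qB].
by rewrite in_cons yp orbT.
Qed.

(** Otherwise a path from [u] back to [B] in [G - z] would give an ear: a path
    [L] with both ends attached to [B], at [z] and at [y != z], and no
    other vertex in [B].  Then [B :|: L] is biconnected, since after deleting
    [w] each remaining vertex of [L] still reaches [B] along one of the two
    directions of [L].  This contradicts the maximality of [B]. *)
Lemma block_ear B z u b :
  block e B -> z \in B -> u \notin B -> e z u -> b \in B -> b != z -> ~~ avoid z u b.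
Proof.
move=> /blockP[/biconnectedP[B0 conB conBw] maxB] zB uB ezu bB bz; apply/negP.
move=> /connectP[p ep lastp].
have zp : z \notin p.
  apply/negP => zp; case/splitPr: zp ep {lastp} => p1 p2; rewrite cat_path /=.
  by case/andP=> _ /andP[/and3P[_]]; rewrite !inE eqxx.
have {}ep : path e u p by apply: sub_path ep => x y /and3P[].
have [|q [y [eq qB ey yB yp]]] := first_hit ep uB; first by rewrite -lastp.
have yz : y != z by apply: contraNneq zp => <-.
case/shortenP: eq ey qB => q' eq' uq' subq ey qB.
have [L [eL uL LB ely uinL]] : exists L, [/\ path e z L, uniq L,
    {in L, forall v, v \notin B}, e (last z L) y & u \in L].
  exists (u :: q'); split; rewrite ?mem_head //= ?ezu //.
  by move=> v; rewrite in_cons => /orP[/eqP->|/subq vq] //; apply: qB; rewrite in_cons vq orbT.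
have notL v : v \in B -> v \notin L by move=> vB; apply/negP => /LB; rewrite vB.
pose S := B :|: [set v in L].
(* [L = q1 ++ x :: q2]; go back to [z] if [w] is not met on the way, and
   forward to [y] otherwise. *)
have conL w x : x \in L -> x != w ->
    exists2 b', b' \in B :\ w & connect (induced e (S :\ w)) x b'.
  move=> xL xw; rewrite /S; case/splitPr: xL eL uL ely notL {S LB uinL} => q1 q2.
  rewrite cat_path last_cat => /andP[eq1 /= /andP[elx eq2]].
  rewrite cat_uniq => /and3P[_ disj _] ely notL.
  have [wq1|wq1] := boolP (w \in z :: q1).
    have wq2 : w \notin x :: q2.
      move: wq1; rewrite [w \in z :: _]in_cons => /orP[/eqP->|wq1].
        by apply: contra (notL z zB) => zq; rewrite mem_cat zq orbT.
      by apply: contraL disj => wq2; rewrite negbK; apply/hasP; exists w.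
    have yw : y != w.
      apply: contraTneq wq1 => <-; rewrite in_cons (negPf yz) /=.
      by apply: contra (notL y yB) => yq; rewrite mem_cat yq.
    exists y; first by rewrite !inE yw.
    rewrite -[X in connect _ _ X](last_rcons x q2 y).
    apply: induced_path; first by rewrite rcons_path eq2.
    move=> v; rewrite -rcons_cons mem_rcons in_cons => /orP[/eqP->|vq2].
      by rewrite !inE yw yB.
    rewrite in_setD1 in_setU inE mem_cat vq2 !orbT andbT.
    by apply: contraNneq wq2 => <-.
  have zw : z != w by apply: contraNneq wq1 => <-; rewrite mem_head.
  exists z; first by rewrite !inE zw.
  rewrite (sym_connect_sym (induced_sym _)) -[X in connect _ _ X](last_rcons z q1 x).
  apply: induced_path; first by rewrite rcons_path eq1.
  move=> v; rewrite -rcons_cons mem_rcons in_cons => /orP[/eqP->|].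
    by rewrite in_setD1 in_setU inE mem_cat mem_head !orbT andbT.
  rewrite in_cons => /orP[/eqP->|vq1]; first by rewrite !inE zw zB.
  rewrite in_setD1 in_setU inE mem_cat vq1 !orbT andbT.
  by apply: contraNneq wq1 => <-; rewrite in_cons vq1 orbT.
have sBS : B \subset S by exact: subsetUl.
have conSw w x : x \in S -> x != w ->
    exists2 b', b' \in B :\ w & connect (induced e (S :\ w)) x b'.
  case/setUP=> [xB|]; last by rewrite inE; exact: conL.
  by move=> xw; exists x; rewrite ?connect0 // !inE xw.
have bS : biconnected S.
  apply/biconnectedP; split.
  - by apply: contraNneq B0 => S0; rewrite -subset0 -S0.
  (* Any [w != x] gives a link from [x] to [B]. *)
  - have toB x : x \in S -> exists2 b', b' \in B & connect (induced e S) x b'.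
      move=> xS; have [w xw] : exists w, x != w.
        by have [->|xz] := eqVneq x z; [exists b; rewrite eq_sym | exists z].
      have [b' /setD1P[_ b'B] xb'] := conSw w x xS xw.
      by exists b' => //; apply: sub_induced xb'; exact: subsetDl.
    move=> x x' /toB[b1 b1B xb1] /toB[b2 b2B xb2].
    apply: connect_trans xb1 _; rewrite (sym_connect_sym (induced_sym _)).
    apply: connect_trans xb2 _; apply: sub_induced sBS _; exact: conB.
  - move=> w x x' /setD1P[xw xS] /setD1P[x'w x'S].
    have [b1 b1B xb1] := conSw w x xS xw; have [b2 b2B xb2] := conSw w x' x'S x'w.
    apply: connect_trans xb1 _; rewrite (sym_connect_sym (induced_sym _)).
    apply: connect_trans xb2 _; apply: sub_induced (setSD _ sBS) _; exact: conBw.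
by have := notL u; rewrite uinL -(maxB S bS sBS) !inE uinL orbT => /(_ isT).
Qed.

(** The gate [z] is the last vertex of [B] on a path from [B] to [b]. *)
Lemma block_gate B b : block e B -> b \notin B ->
  exists2 z, z \in B & forall x, x \in B -> x != z -> ~~ avoid z x b.
Proof.
move=> blkB bB; have /blockP[/biconnectedP[/set0Pn[x0 x0B] _ _] _] := blkB.
have /connectP[p ep lastp] := connectT b x0.
have [|q [z [eq qB ez zB _]]] := first_hit ep bB; first by rewrite -lastp.
exists z => // x xB xz; rewrite avoid_sym //.
have bu : avoid z b (last b q).
  by apply: avoid_path => //; apply/negP => /qB; rewrite zB.
apply/negP => bx; have := block_ear blkB zB (qB _ (mem_last b q)) _ xB xz.
rewrite e_sym ez => /(_ isT)/negP; apply.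
by apply: avoid_trans bx; rewrite avoid_sym.
Qed.

Lemma articulationP z x y : x != z -> y != z -> ~~ avoid z x y -> articulation e z.
Proof.
move=> xz yz nxy; rewrite /articulation /cutvertex inE /=.
apply/exists_inP; exists x; first by rewrite !inE xz.
apply/exists_inP; exists y; first by rewrite !inE yz.
rewrite nxy andbT; have /connected_inP[_] := e_conn.
by apply; rewrite inE.
Qed.

Lemma block_articulation B z u b : block e B -> z \in B -> u \notin B -> e z u ->
  b \in B -> b != z -> articulation e z.
Proof.
move=> blkB zB uB ezu bB bz.
apply: (@articulationP z u b) => //; last exact: block_ear ezu bB bz.
by apply: contraNneq uB => ->.
Qed.

(** A path that starts in [B] either stays there, and then its end is the required
    articulation point, or leaves [B] at a vertex which is one by [block_ear].
    The vertex [b] guarantees that [B] has a vertex off the path. *)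
Lemma block_exit B a l b : block e B -> a \in B -> path e a l -> b \in B ->
  b \notin a :: l -> articulation e (last a l) ->
  exists2 q, q \in a :: l & (q \in B) && articulation e q.
Proof.
move=> blkB + + bB; elim: l a => [|u l IHl] a aB /=.
  by move=> _ _ art_a; exists a; rewrite ?mem_head ?aB.
case/andP=> eau el; rewrite in_cons negb_or => /andP[ba bl] art.
have [uB|uB] := boolP (u \in B).
  have [q ql qP] := IHl u uB el bl art; exists q => //.
  by rewrite in_cons ql orbT.
exists a; first exact: mem_head.
by rewrite aB (block_articulation blkB aB uB eau bB ba).
Qed.

Lemma last_rev_belast (x : T) p : last (last x p) (rev (belast x p)) = x.
Proof. by case: p => //= y p; rewrite rev_cons last_rcons. Qed.

(** If [x] did not separate [s] from [y], the neighbours of [x] on the path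
    would be joined in [G - x], hence lie with [x] in a common block [B].
    Following the path from [x] in both directions, [block_exit] finds an
    articulation point of [B] on either side; with [x] these are three on a
    pure path. *)
Lemma pure_path_separates s p1 x p2 y :
  pure_path e s (p1 ++ x :: p2) -> articulation e s -> articulation e x ->
  articulation e y -> y \in p2 -> ~~ avoid x s y.
Proof.
move=> [/andP[ep up] pure] art_s art_x art_y yp2; apply/negP => sy.
move: ep; rewrite cat_path => /andP[ep1 /= /andP[ex ep2]].
move: (up); rewrite -cat_cons cat_uniq => /and3P[up1 disj /= /andP[xp2 up2]].
have xp1 : x \notin s :: p1.
  by apply: contra disj => xp1; apply/hasP; exists x; rewrite ?mem_head.
case: p2 => [//|u p2] in yp2 ep2 xp2 up up2 disj pure *.
have /= /andP[exu {}ep2] := ep2.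
have uy : avoid x u y by exact: avoid_mem yp2.
have su : avoid x s u by apply: avoid_trans sy _; rewrite avoid_sym.
have [B [blkB xB uB]] := edge_block exu.
have ux : u != x by apply: contraNneq xp2 => ->; rewrite mem_head.
have mB : last s p1 \in B.
  apply/negPn/negP => mB.
  have := block_ear blkB xB mB _ uB ux; rewrite e_sym => /(_ ex)/negP; apply.
  by apply: avoid_trans su; rewrite avoid_sym // avoid_path.
have [q1 q1p /andP[q1B art_q1]] : exists2 q, q \in s :: p1 & (q \in B) && articulation e q.
  have memE : last s p1 :: rev (belast s p1) =i s :: p1.
    by move=> v; rewrite [s :: p1]lastI mem_rcons !in_cons mem_rev.
  have [||||q qp qP] := @block_exit B (last s p1) (rev (belast s p1)) x blkB mB.
  - by rewrite rev_path (eq_path (e' := e)) // => v w; rewrite e_sym.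
  - exact: xB.
  - by rewrite memE.
  - by rewrite last_rev_belast.
  by exists q => //; rewrite -memE.
have [q2 q2p /andP[q2B art_q2]] : exists2 q, q \in u :: p2 & (q \in B) && articulation e q.
  case/splitPl: yp2 xp2 ep2 {up up2 disj pure} => l l' lasty xl.
  rewrite cat_path => /andP[el _].
  have [||q ql qP] := block_exit blkB uB el xB.
  - by apply: contra xl => xl; rewrite -cat_cons mem_cat xl.
  - by rewrite lasty.
  by exists q => //; rewrite -cat_cons mem_cat ql.
have q1x : q1 != x by apply: contraNneq xp1 => <-.
have q2x : q2 != x by apply: contraNneq xp2 => <-.
have q12 : q1 != q2.
  apply: contraNneq disj => q12; apply/hasP; exists q2; last by rewrite -q12.
  by rewrite in_cons q2p orbT.
have := pure B blkB; rewrite leqNgt => /negP; apply.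
apply: (@leq_trans #|q1 |: [set q2; x]|).
  by rewrite cardsU1 cards2 !inE (negPf q1x) (negPf q12) (negPf q2x).
apply/subset_leq_card/subsetP => v /setU1P[->|/set2P[]->]; rewrite in_set -cat_cons mem_cat.
- by rewrite q1B art_q1 q1p.
- by rewrite q2B art_q2 [q2 \in x :: _]in_cons q2p !orbT.
- by rewrite xB art_x (mem_head x) orbT.
Qed.
End Blocks.

(** * The Laplacian as an operator on functions *)

Section Laplacian.
Variable R : rcfType.
Hypothesis e_irr : irreflexive e.

(** The normalized Laplacian becomes [lap] under the substitution
    [g = D^(1/2) y], see [nlap_mul]; working with [y] removes all square roots. *)
Definition lap (y : T -> R) (v : T) : R := \sum_(u | e v u) (y v - y u).

Definition shifted_lap (lam : R) (y : T -> R) (v : T) : R :=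
  lap y v - lam * (deg e v)%:R * y v.

Lemma lapE y v : lap y v = (deg e v)%:R * y v - \sum_(u | e v u) y u.
Proof.
by rewrite /lap sumrB sumr_const /deg cardsE mulr_natl.
Qed.

Lemma lap_lin c x y v : lap (fun u => c * x u + y u) v = c * lap x v + lap y v.
Proof.
by rewrite /lap mulr_sumr -big_split /=; apply: eq_bigr => u _; ring.
Qed.

Lemma shifted_lap_lin lam c x y v :
  shifted_lap lam (fun u => c * x u + y u) v =
  c * shifted_lap lam x v + shifted_lap lam y v.
Proof. by rewrite /shifted_lap lap_lin; ring. Qed.

Lemma lap_swap (F : T -> T -> R) :
  \sum_v \sum_(u | e v u) F v u = \sum_v \sum_(u | e v u) F u v.
Proof.
rewrite (exchange_big_dep xpredT) //=; apply: eq_bigr => v _.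
by apply: eq_bigl => u; rewrite e_sym.
Qed.

Lemma sum_lap y : \sum_v lap y v = 0.
Proof.
have /eqP : (\sum_v lap y v) *+ 2 = 0.
  rewrite mulr2n /lap {1}lap_swap -big_split /= big1 // => v _.
  by rewrite -big_split big1 //= => u _; ring.
by rewrite mulrn_eq0 => /eqP.
Qed.

Lemma dirichlet y :
  (\sum_v y v * lap y v) *+ 2 = \sum_v \sum_(u | e v u) (y v - y u) ^+ 2.
Proof.
under eq_bigr do rewrite mulr_sumr.
rewrite mulr2n {1}lap_swap -big_split /=; apply: eq_bigr => v _.
by rewrite -big_split; apply: eq_bigr => u _ /=; ring.
Qed.

Lemma dirichlet_ge0 y : 0 <= \sum_v y v * lap y v.
Proof.
rewrite -(pmulrn_lge0 _ (isT : (0 < 2)%N)) dirichlet.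
by apply: sumr_ge0 => v _; apply: sumr_ge0 => u _; exact: sqr_ge0.
Qed.

Lemma lap_kernel_const y : (forall v, lap y v = 0) -> forall u v, y u = y v.
Proof.
move=> y0 u v; apply/esym; apply: (@closed_total (fun v => y v = y u) u v) => // {v} v w <- evw.
have /eqP := dirichlet y; rewrite [in X in X == _]big1 ?mul0rn; last first.
  by move=> x _; rewrite y0 mulr0.
have sq_ge0 x : 0 <= \sum_(u | e x u) (y x - y u) ^+ 2.
  by apply: sumr_ge0 => *; exact: sqr_ge0.
rewrite eq_sym psumr_eq0 // => /allP/(_ v (mem_index_enum v))/=.
rewrite psumr_eq0 => [/allP/(_ w (mem_index_enum w))|*]; last exact: sqr_ge0.
by rewrite evw sqrf_eq0 subr_eq0 => /eqP.
Qed.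

Hypothesis T_ge2 : (2 <= #|T|)%N.

Lemma degree_gt0 v : (0 < deg e v)%N.
Proof.
rewrite lt0n; apply/negP => /eqP/cards0_eq nbr0.
have [x _ xv] : exists2 x, x \in T & x != v.
  have /card_gt1P[a [b [_ _ ab]]] := T_ge2.
  by have [av|] := eqVneq a v; [exists b; rewrite // -av eq_sym | exists a].
have xv' : x = v.
  apply: (@closed_total (fun x => x = v) v x) => // {x xv} x y -> evy.
  by have := in_set0 y; rewrite -nbr0 inE evy.
by rewrite xv' eqxx in xv.
Qed.

Definition rdeg v : R := Num.sqrt (deg e v)%:R.

Lemma rdeg_gt0 v : 0 < rdeg v.
Proof. by rewrite sqrtr_gt0 ltr0n degree_gt0. Qed.

Lemma rdeg_sqr v : rdeg v * rdeg v = (deg e v)%:R.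
Proof. by rewrite -expr2 sqr_sqrtr // ler0n. Qed.

Lemma nlap_sym : (nlap R e)^T = nlap R e.
Proof.
apply/matrixP => i j; rewrite !mxE /nlap_entry eq_sym e_sym.
by rewrite [(deg _ _)%:R * _]mulrC.
Qed.

Lemma nlap_colvec y v :
  (nlap R e *m colvec (fun v => rdeg v * y v)) (enum_rank v) 0 = (rdeg v)^-1 * lap y v.
Proof.
have S0 u := lt0r_neq0 (rdeg_gt0 u).
rewrite mxE; under eq_bigr do rewrite !mxE enum_rankK.
rewrite -(big_enum_val (A := T) (fun u => nlap_entry R e v u * (rdeg u * y u))) /=.
rewrite (bigD1 v) //= {1}/nlap_entry eqxx mul1r lapE mulrBr -rdeg_sqr -[X in _ = _ * X - _]mulrA.
rewrite mulKf // -mulrN; congr (_ + _).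
rewrite -sumrN mulr_sumr [RHS]big_mkcond [LHS]big_mkcond; apply: eq_bigr => u _ /=.
have [->|uv] := eqVneq u v; first by rewrite e_irr.
rewrite /nlap_entry eq_sym (negPf uv); case: (e v u); last by rewrite mul0r.
by rewrite sqrtrM ?ler0n // -/(rdeg u) -/(rdeg v); field; rewrite !S0.
Qed.

Lemma colvec_surj (x : 'cV[R]_#|T|) :
  exists y, x = colvec (fun v => rdeg v * y v).
Proof.
exists (fun v => (rdeg v)^-1 * x (enum_rank v) 0); apply/colP => i.
by rewrite !mxE enum_valK mulVKf // lt0r_neq0 ?rdeg_gt0.
Qed.

Lemma colvec_dot (x y : T -> R) :
  ((colvec x)^T *m colvec y) 0 0 = \sum_v x v * y v.
Proof.
rewrite mxE; under eq_bigr do rewrite !mxE.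
by rewrite -(big_enum_val (A := T) (fun v => x v * y v)).
Qed.

Lemma nlap_mul y : nlap R e *m colvec (fun v => rdeg v * y v) =
  colvec (fun v => (rdeg v)^-1 * lap y v).
Proof.
by apply/colP => j; rewrite -[j]enum_valK nlap_colvec mxE enum_rankK.
Qed.

Lemma nlap_quadratic y :
  ((colvec (fun v => rdeg v * y v))^T *m nlap R e *m colvec (fun v => rdeg v * y v)) 0 0
  = \sum_v y v * lap y v.
Proof.
rewrite -mulmxA nlap_mul colvec_dot; apply: eq_bigr => v _.
by field; rewrite lt0r_neq0 ?rdeg_gt0.
Qed.

(** Under [g = D^(1/2) y], orthogonality to the kernel vector [D^(1/2) 1] of the
    normalized Laplacian says that [y] has degree-weighted mean zero. *)
Lemma rayleigh_lambda1 lam (lam1 : is_lambda e 1 lam) :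
  0 < lam /\
  forall y, \sum_v (deg e v)%:R * y v = 0 ->
    \sum_v y v * shifted_lap lam y v <= 0 -> forall v, shifted_lap lam y v = 0.
Proof.
case: lam1 => s [specs s_gt1 ->]; pose k := colvec (fun v => rdeg v * 1).
have [||||s1_gt0 rq] := second_eigenvalue_rayleigh (k := k) nlap_sym specs s_gt1.
- by move=> x; have [y ->] := colvec_surj x; rewrite nlap_quadratic dirichlet_ge0.
- have /card_gt0P[v _] : (0 < #|T|)%N by apply: leq_trans T_ge2.
  apply/eqP => /colP/(_ (enum_rank v)); rewrite !mxE enum_rankK mulr1 => /eqP.
  by rewrite (negPf (lt0r_neq0 (rdeg_gt0 v))).
- rewrite nlap_mul; apply/colP => i; rewrite !mxE /lap big1 ?mulr0 // => u _.
  exact: subrr.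
- move=> x; have [y ->] := colvec_surj x; rewrite nlap_mul => /colP y0.
  have /card_gt0P[v0 _] : (0 < #|T|)%N by apply: leq_trans T_ge2.
  exists (y v0); apply/colP => i; rewrite !mxE mulr1 mulrC.
  congr (_ * _); apply: lap_kernel_const => v.
  have /eqP := y0 (enum_rank v); rewrite !mxE enum_rankK mulf_eq0 invr_eq0.
  by rewrite (negPf (lt0r_neq0 (rdeg_gt0 v))) => /eqP.
split=> // y y_bal y_le0 v.
have /colP/(_ (enum_rank v)) : nlap R e *m colvec (fun v => rdeg v * y v) =
    s`_1 *: colvec (fun v => rdeg v * y v).
  apply: rq.
    apply/matrixP => i j; rewrite !ord1 colvec_dot mxE -[RHS]y_bal.
    by apply: eq_bigr => u _; rewrite mulr1 mulrA rdeg_sqr.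
  rewrite nlap_quadratic colvec_dot mulr_sumr -subr_le0 -sumrB.
  apply: le_trans y_le0; rewrite le_eqVlt; apply/orP; left; apply/eqP.
  by apply: eq_bigr => u _; rewrite /shifted_lap -rdeg_sqr; ring.
rewrite nlap_colvec !mxE enum_rankK => /(congr1 ( *%R (rdeg v))).
rewrite mulVKf ?lt0r_neq0 ?rdeg_gt0 // /shifted_lap -rdeg_sqr => ->; ring.
Qed.

Lemma harmonic_eigenfunction_kernel lam f : harmonic_eigenfunction e lam f ->
  (exists v, f v != 0) /\ forall v, shifted_lap lam f v = 0.
Proof.
case=> g [[v0 gv0] eig] fE.
have gE : colvec g = colvec (fun v => rdeg v * f v).
  by apply/colP => i; rewrite !mxE fE mulVKf ?lt0r_neq0 ?rdeg_gt0.
split; first by exists v0; rewrite fE -/(rdeg _) mulf_neq0 // invr_neq0 ?lt0r_neq0 ?rdeg_gt0.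
move=> v; move/colP/(_ (enum_rank v)): eig.
rewrite gE nlap_colvec !mxE enum_rankK => /(congr1 ( *%R (rdeg v))).
rewrite mulVKf ?lt0r_neq0 ?rdeg_gt0 // /shifted_lap -rdeg_sqr => ->; ring.
Qed.

End Laplacian.

(** * Signs of a kernel function on the components of [G - z] *)

Section Signs.
Variable R : rcfType.
Hypothesis deg_gt0 : forall v, (0 < deg e v)%N.
Variable lam : R.
Hypothesis lam_gt0 : 0 < lam.
Hypothesis rayleigh : forall y : T -> R, \sum_v (deg e v)%:R * y v = 0 ->
    \sum_v y v * shifted_lap lam y v <= 0 -> forall v, shifted_lap lam y v = 0.

Local Notation M := (shifted_lap lam).
Local Notation in_kernel f := (forall v, M f v = 0).

Lemma kernelN f : in_kernel f -> in_kernel (fun v => - f v).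
Proof.
move=> hf v; rewrite -[RHS](mulr0 (-1)) -(hf v).
by rewrite /shifted_lap /lap mulrBr mulr_sumr; congr (_ - _); [apply: eq_bigr => u _|]; ring.
Qed.

(** Summing [M f = 0] over all vertices, the Laplacian part cancels. *)
Lemma kernel_sum0 f : in_kernel f -> \sum_v (deg e v)%:R * f v = 0.
Proof.
move=> hf; apply: (mulfI (lt0r_neq0 lam_gt0)); rewrite mulr0 mulr_sumr.
rewrite -[RHS](sum_lap f); apply: eq_bigr => v _.
by apply/eqP; rewrite mulrA eq_sym -subr_eq0; apply/eqP; exact: hf.
Qed.

Lemma shifted_lap_zero y v : y v = 0 -> M y v = - \sum_(u | e v u) y u.
Proof. by move=> yv; rewrite /shifted_lap lapE yv !mulr0 subr0 add0r. Qed.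

(** At a zero [u] of [w] the equation reads [\sum_(v ~ u) w v = 0] with
    nonnegative terms, so zeros propagate along edges inside the component and
    to [z], but not through [z]. *)
Lemma strong_min_principle w z c :
  c != z -> 0 <= w z -> (forall v, avoid z c v -> 0 <= w v) ->
  (forall v, avoid z c v -> M w v = 0) -> w c = 0 ->
  w z = 0 /\ forall v, avoid z c v -> w v = 0.
Proof.
move=> cz wz w_ge0 Mw wc.
pose P v := w v = 0 /\ (v = z \/ avoid z c v).
have stepP u v : u != z -> P u -> e u v -> P v.
  move=> uz [wu [/eqP|cu]]; first by rewrite (negPf uz).
  have nbr x : e u x -> x = z \/ avoid z c x.
    move=> eux; have [->|xz] := eqVneq x z; [by left | right].
    exact: avoid_trans cu (avoid_edge uz xz eux).
  move=> euv; split; last exact: nbr.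
  have /eqP := Mw u cu; rewrite shifted_lap_zero // oppr_eq0 psumr_eq0.
    by move=> /allP/(_ v (mem_index_enum v))/implyP/(_ euv)/eqP.
  by move=> x /nbr[->|/w_ge0].
have Pc : P c by split=> //; right; exact: avoid_refl.
have Pz : w z = 0.
  have [/eqP //|wz0] := boolP (w z == 0).
  have [] // := @closed_total P c z _ Pc.
  by move=> u v Pu; apply: stepP => //; apply: contraNneq wz0 => <-; case: Pu => ->.
split=> // v cv; have [] : P v /\ v != z; last by case.
apply: (@avoid_ind z (fun v => P v /\ v != z) c v _ cv); last by split.
by move=> x y yz [Px xz] exy; split=> //; exact: stepP exy.
Qed.

(** With [C_a], [C_b] the two components, let [p] be [al * min(f, 0)] on [C_a],
    [be * min(f, 0)] on [C_b] and 0 elsewhere, with [al > 0 > be] chosen so that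
    [p] has mean zero.  At a negative vertex of either component, replacing
    [f] by [min(f, 0)] inside and [f z] by 0 only decreases the neighbour sum, so
    [p v * (M p) v <= 0] everywhere and [p] is in the kernel of [M].  Then
    [al * f - p] is a kernel function, nonnegative on [C_a] and at [z], which
    vanishes at [a]. *)
Lemma two_negative_components f z a b :
  in_kernel f -> 0 <= f z -> a != z -> b != z -> ~~ avoid z a b ->
  f a < 0 -> f b < 0 -> f z = 0 /\ forall c, avoid z a c -> f c < 0.
Proof.
move=> hf fz az bz nab fa fb.
have ngz c : c != z -> avoid z c z = false.
  by move=> cz; apply/negP => /avoid_neq/(_ cz)/eqP.
pose neg v := Num.min (f v) 0.
pose mass c := \sum_(v | avoid z c v) (deg e v)%:R * neg v.
have neg_le0 v : neg v <= 0 by rewrite /neg ge_min lexx orbT.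
have mass_lt0 c : f c < 0 -> mass c < 0.
  move=> fc; rewrite /mass (bigD1 c) /=; last exact: avoid_refl.
  apply: ltr_wnDr; first by apply: sumr_le0 => v _; rewrite mulr_ge0_le0.
  by rewrite /neg min_l ?ltW // pmulr_rlt0 // ltr0n.
pose al := - mass b; pose be := mass a.
have al_gt0 : 0 < al by rewrite oppr_gt0 mass_lt0.
pose p v := if avoid z a v then al * neg v else if avoid z b v then be * neg v else 0.
have disj v : avoid z a v -> avoid z b v = false.
  move=> av; apply: contraNF nab => bv; apply: connect_trans av _.
  by rewrite -/(avoid z v b) avoid_sym.
have pz : p z = 0 by rewrite /p !ngz.
have p_sum0 : \sum_v (deg e v)%:R * p v = 0.
  rewrite (bigID (avoid z a)) /= [X in _ + X](bigID (avoid z b)) /=.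
  rewrite [X in _ + (_ + X)]big1 ?addr0; last first.
    by move=> v /andP[/negPf av /negPf bv]; rewrite /p av bv mulr0.
  have -> : \sum_(v | avoid z a v) (deg e v)%:R * p v = al * mass a.
    rewrite mulr_sumr; apply: eq_bigr => v av; rewrite /p av; ring.
  have -> : \sum_(v | ~~ avoid z a v && avoid z b v) (deg e v)%:R * p v = be * mass b.
    rewrite mulr_sumr; apply: eq_big => [v|v /andP[/negPf av bv]].
      by case: (boolP (avoid z a v)) => //= /disj.
    by rewrite /p av bv; ring.
  by rewrite /al /be; ring.
have term c k : c != z -> (forall v, avoid z c v -> p v = k * neg v) ->
  forall v, avoid z c v -> p v * M p v <= 0.
  move=> cz pE v cv; have [fv|fv] := ltP (f v) 0; last first.
    by rewrite pE // /neg min_r // mulr0 mul0r.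
  have pv : p v = k * f v by rewrite pE // /neg min_l // ltW.
  have -> : M p v = k * \sum_(u | e v u) (if u == z then f z else f u - neg u).
    have -> : M p v = M p v - k * M f v by rewrite hf mulr0 subr0.
    rewrite /shifted_lap /lap pv mulr_sumr.
    rewrite (_ : forall x y d l : R, x - l * d * (k * f v) - k * (y - l * d * f v) = x - k * y);
      last by move=> *; ring.
    rewrite mulr_sumr -sumrB; apply: eq_bigr => u evu.
    case: eqP => [->|/eqP uz]; first by rewrite pz; ring.
    rewrite pE; first by ring.
    exact: avoid_trans cv (avoid_edge (avoid_neq cv cz) uz evu).
  rewrite pv mulrACA -expr2 mulr_ge0_le0 ?sqr_ge0 //.
  apply: mulr_le0_ge0 (ltW fv) _; apply: sumr_ge0 => u _.
  by case: eqP => // _; rewrite subr_ge0 /neg ge_min lexx.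
have Mp v : M p v = 0.
  apply: rayleigh p_sum0 _ v; apply: sumr_le0 => v _.
  have [av|nav] := boolP (avoid z a v).
    by apply: (term a al) => // u au; rewrite /p au.
  have [bv|nbv] := boolP (avoid z b v).
    apply: (term b be) => // u bu; rewrite /p bu.
    by case: (boolP (avoid z a u)) => // /disj; rewrite bu.
  by rewrite {1}/p (negPf nav) (negPf nbv) mul0r.
(* The shape of [w] is that of [shifted_lap_lin]. *)
pose w v := - 1 * p v + (al * f v + 0).
have Mw v : M w v = 0.
  rewrite shifted_lap_lin shifted_lap_lin Mp hf !mulr0 !add0r.
  by rewrite shifted_lap_zero // big1 ?oppr0.
have wE v : avoid z a v -> w v = al * (f v - neg v).
  by move=> av; rewrite /w /p av; ring.
have [||||wz w0] := @strong_min_principle w z a az.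
- by rewrite /w pz; rewrite mulr0 add0r addr0 mulr_ge0 // ltW.
- by move=> v av; rewrite wE // (mulr_ge0 (ltW al_gt0)) // subr_ge0 /neg ge_min lexx.
- by move=> v _; exact: Mw.
- by rewrite (wE a (avoid_refl z a)) /neg min_l ?subrr ?mulr0 ?ltW.
have fz0 : f z = 0.
  by move: wz; rewrite /w pz mulr0 add0r addr0 => /eqP; rewrite mulf_eq0 (gt_eqF al_gt0) => /eqP.
have f_le0 v : avoid z a v -> f v <= 0.
  move=> av; have /eqP := w0 v av; rewrite wE // mulf_eq0 (gt_eqF al_gt0) subr_eq0 => /eqP->.
  exact: neg_le0.
split=> // c ac; rewrite lt_neqAle f_le0 // andbT; apply/eqP => fc.
have ca : avoid z c a by rewrite avoid_sym.
have cz := avoid_neq ac az.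
have [||||_ /(_ a ca)/eqP] := @strong_min_principle (fun v => - f v) z c cz.
- by rewrite fz0 oppr0.
- by move=> v cv; rewrite oppr_ge0 f_le0 // (avoid_trans ac cv).
- by move=> v _; exact: kernelN.
- by rewrite fc oppr0.
by rewrite oppr_eq0 (lt_eqF fa).
Qed.

(** A nonzero [f b] would share its sign with [a] or [a'], and then
    [two_negative_components], applied to [f] or [-f], gives its component a
    strict sign. *)
Lemma mixed_component_exclusive f z a a' b :
  in_kernel f -> f z = 0 -> a != z -> b != z -> avoid z a a' -> ~~ avoid z a b ->
  0 < f a -> f a' < 0 -> f b = 0.
Proof.
move=> hf fz az bz aa' nab fa fa'.
have a'z := avoid_neq aa' az.
have na'b : ~~ avoid z a' b by apply: contra nab; exact: avoid_trans.
have [fb|fb|//] := ltgtP (f b) 0.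
  have fz_ge0 : 0 <= f z by rewrite fz.
  have [_ /(_ a)] := two_negative_components hf fz_ge0 a'z bz na'b fa' fb.
  by rewrite avoid_sym // => /(_ aa'); rewrite ltNge ltW.
have fz_ge0 : 0 <= - f z by rewrite fz oppr0.
have [|| _ /(_ a' aa')] := two_negative_components (kernelN hf) fz_ge0 az bz nab.
- by rewrite oppr_lt0.
- by rewrite oppr_lt0.
by rewrite oppr_lt0 ltNge ltW.
Qed.

(** By the maximum principle a component of [G - z] with a nonpositive value
    also has a negative one, because [f z != 0]; two such components are
    excluded by [two_negative_components]. *)
Lemma component_positive_of_sibling f z a b :
  in_kernel f -> 0 < f z -> a != z -> b != z -> ~~ avoid z a b ->
  f a <= 0 -> 0 < f b.
Proof.
move=> hf fz az bz nab fa; rewrite ltNge; apply/negP => fb.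
have neg c : c != z -> f c <= 0 -> exists2 c', avoid z c c' & f c' < 0.
  move=> cz fc; have [/existsP[c' /andP[]]|] := boolP [exists v, avoid z c v && (f v < 0)].
    by exists c'.
  rewrite negb_exists => /forallP f_ge0.
  have f_ge0' v : avoid z c v -> 0 <= f v.
    by move=> cv; have := f_ge0 v; rewrite cv leNgt.
  have fc0 : f c = 0 by apply/eqP; rewrite eq_le fc f_ge0' // avoid_refl.
  have [] := strong_min_principle cz (ltW fz) f_ge0' (fun v _ => hf v) fc0.
  by move=> fz0; rewrite fz0 ltxx in fz.
have [a' aa' fa'] := neg a az fa; have [b' bb' fb'] := neg b bz fb.
have nab' : ~~ avoid z a' b'.
  apply: contra nab => a'b'; apply: avoid_trans aa' _.
  by apply: avoid_trans a'b' _; rewrite avoid_sym.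
have a'z := avoid_neq aa' az; have b'z := avoid_neq bb' bz.
have [fz0 _] := two_negative_components hf (ltW fz) a'z b'z nab' fa' fb'.
by rewrite fz0 ltxx in fz.
Qed.

(** If the component of [c] took both signs, [f] would vanish at [w] or [w'],
    one of which is in another component; if it only had nonnegative values
    with a zero at [v], it would vanish at [c]. *)
Lemma component_positive f z w w' c v :
  in_kernel f -> f z = 0 -> w != z -> w' != z -> ~~ avoid z w w' ->
  0 < f w -> f w' < 0 -> c != z -> avoid z c v -> 0 < f c -> 0 < f v.
Proof.
move=> hf fz wz w'z nww' fw fw' cz cv fc; rewrite ltNge; apply/negP => fv.
have [/existsP[c' /andP[cc' fc']]|] := boolP [exists u, avoid z c u && (f u < 0)].
  have excl b : b != z -> ~~ avoid z c b -> f b = 0.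
    by move=> bz ncb; exact: mixed_component_exclusive cc' ncb fc fc'.
  have [cw|ncw] := boolP (avoid z c w).
    rewrite (excl w') ?ltxx // in fw'; apply: contra nww'.
    by apply: avoid_trans; rewrite avoid_sym.
  by rewrite (excl w) ?ltxx in fw.
rewrite negb_exists => /forallP f_lt0.
have f_ge0 u : avoid z c u -> 0 <= f u.
  by move=> cu; have := f_lt0 u; rewrite cu leNgt.
have vz := avoid_neq cv cz.
have v_ge0 u : avoid z v u -> 0 <= f u.
  by move=> vu; apply: f_ge0; exact: avoid_trans cv vu.
have fv0 : f v = 0 by apply/eqP; rewrite eq_le fv f_ge0.
have [|_ /(_ c)] := strong_min_principle vz _ v_ge0 (fun v _ => hf v) fv0.
  by rewrite fz.
by rewrite avoid_sym // => /(_ cv) fc0; rewrite fc0 ltxx in fc.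
Qed.

(** [f] has no minimum over the component and [x] inside the component, where
    [lap f > 0]. *)
Lemma increase_past f x y :
  in_kernel f -> y != x -> (forall v, avoid x y v -> 0 < f v) -> f x < f y.
Proof.
move=> hf yx f_gt0; rewrite ltNge; apply/negP => fyx.
have [m ym m_min] : exists2 m, avoid x y m & forall v, avoid x y v -> f m <= f v.
  have yy : avoid x y y by exact: avoid_refl.
  by case: (arg_minP f yy) => m ym m_min; exists m.
have mx := avoid_neq ym yx.
have /eqP := hf m; rewrite subr_eq0 => /eqP lap_m.
have : 0 < lap f m.
  by rewrite lap_m; apply: mulr_gt0 (f_gt0 m ym); apply: mulr_gt0 => //; rewrite ltr0n.
rewrite ltNge => /negP; apply; apply: sumr_le0 => u emu; rewrite subr_le0.
have [->|ux] := eqVneq u x; first by apply: le_trans fyx; apply: m_min; exact: avoid_refl.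
by apply: m_min; exact: avoid_trans ym (avoid_edge mx ux emu).
Qed.

(** * Monotonicity along pure paths *)

Lemma sorted_map_filter (f : T -> R) (P : pred T) p :
  (forall p1 x p2 y, p = p1 ++ x :: p2 -> P x -> P y -> y \in p2 -> f x < f y) ->
  sorted <%R [seq f v | v <- p & P v].
Proof.
rewrite (sorted_pairwise lt_trans); elim: p => //= x p IHp lt_f.
have tail : pairwise <%R [seq f v | v <- p & P v].
  by apply: IHp => p1 y p2 w pE; apply: (lt_f (x :: p1)); rewrite pE.
case: ifP => //= Px; rewrite tail andbT; apply/allP => _ /mapP[y + ->].
by rewrite mem_filter => /andP[Py yp]; apply: (lt_f [::] x p y).
Qed.

Lemma increasing_opp (f : T -> R) p :
  increasing_seq (art_values e (fun v => - f v) p) -> decreasing_seq (art_values e f p).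
Proof.
rewrite /increasing_seq /decreasing_seq /art_values !sorted_map.
by apply: sub_sorted => x y; rewrite /= ltrN2.
Qed.

(** For [x] before [y], [x] separates [y] from [s], hence from the nonpositive
    vertex [a]; so the component of [G - x] that contains [y] is positive. *)
Lemma increasing_along f s p :
  in_kernel f -> pure_path e s p -> articulation e s ->
  (forall x, x \in p -> 0 < f x) ->
  (forall x, x \in p -> exists2 a, avoid x s a & f a <= 0) ->
  increasing_seq (art_values e f p).
Proof.
move=> hf pure art_s f_gt0 bad; apply: sorted_map_filter => p1 x p2 y pE art_x art_y yp2.
have nsy : ~~ avoid x s y.
  by apply: (@pure_path_separates s p1 x p2 y) => //; rewrite -pE.
have up : uniq (s :: p) by case: pure => /andP[].
have xp : x \in p by rewrite pE mem_cat mem_head orbT.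
have sx : s != x by apply: contraTneq up => ->; rewrite /= xp.
have yx : y != x.
  move: up; rewrite /= pE cat_uniq /= => /and3P[_ _ /and3P[_ + _]].
  by apply: contraNneq => <-.
have [a sa fa] := bad x xp; apply: (increase_past hf yx) => v yv.
apply: (component_positive_of_sibling hf (f_gt0 x xp)) fa.
- exact: avoid_neq sa sx.
- exact: avoid_neq yv yx.
apply: contra nsy => av; apply: avoid_trans sa (avoid_trans av _).
by rewrite avoid_sym.
Qed.

Lemma exists_positive f : in_kernel f -> (exists v, f v != 0) -> exists v, 0 < f v.
Proof.
move=> hf [v0 fv0]; apply/existsP; apply: contraNT fv0.
rewrite negb_exists => /forallP f_le0.
have : \sum_v (deg e v)%:R * - f v == 0.
  have := kernel_sum0 (kernelN hf) => /= ->; exact: eqxx.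
rewrite psumr_eq0 => [/allP/(_ v0 (mem_index_enum v0))/=|v _].
  by rewrite mulf_eq0 oppr_eq0 pnatr_eq0 (gtn_eqF (deg_gt0 v0)).
by rewrite mulr_ge0 ?ler0n // oppr_ge0 leNgt.
Qed.

Lemma opposite_neighbor f z w : in_kernel f -> f z = 0 -> e z w -> 0 < f w ->
  exists2 w', e z w' & f w' < 0.
Proof.
move=> hf fz ezw fw; apply/exists_inP; apply: contraTT fw.
rewrite negb_exists_in => /forall_inP f_ge0.
have /eqP := hf z; rewrite (shifted_lap_zero fz) oppr_eq0 psumr_eq0 => [|u eu].
  by move/allP/(_ w (mem_index_enum w)); rewrite ezw /= => /eqP->; rewrite ltxx.
by rewrite leNgt f_ge0.
Qed.

Lemma mixed_blockN (f : T -> R) B : mixed_block e f B -> mixed_block e (fun v => - f v) B.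
Proof.
case=> blkB [a aB fa] [b bB fb]; split=> //.
  by exists b => //; rewrite oppr_gt0.
by exists a => //; rewrite oppr_lt0.
Qed.

(** * No mixed block *)

Section NoMixed.
Variable f : T -> R.
Hypothesis hf : in_kernel f.
Hypothesis no_mixed : forall B, ~ mixed_block e f B.

(** The block of the edge [z w] would be mixed if it contained [w']. *)
Lemma frontier_separates z w w' : e z w -> e z w' -> 0 < f w -> f w' < 0 -> f z = 0 ->
  ~~ avoid z w w'.
Proof.
move=> ezw ezw' fw fw' fz; have [B [blkB zB wB]] := edge_block ezw.
rewrite avoid_sym //; apply: (block_ear blkB zB _ ezw' wB _).
  by apply/negP => w'B; apply: (@no_mixed B); split=> //; [exists w | exists w'].
by apply: contraTneq fw => ->; rewrite fz ltxx.
Qed.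

Lemma frontier_sides z : f z = 0 -> (exists2 w, e z w & f w != 0) ->
  exists w w', [/\ e z w, 0 < f w, w' != z, f w' < 0 & ~~ avoid z w w'].
Proof.
move=> fz [w ezw fw].
have [w1 [w2 [ez1 ez2 f1 f2]]] : exists w1 w2, [/\ e z w1, e z w2, 0 < f w1 & f w2 < 0].
  case: (ltgtP (f w) 0) fw => // [fw|fw] _.
    have [||w' ezw' fw'] := @opposite_neighbor _ z w (kernelN hf) _ ezw.
    - by rewrite fz oppr0.
    - by rewrite oppr_gt0.
    by exists w', w; rewrite oppr_lt0 in fw'.
  by have [w' ezw' fw'] := opposite_neighbor hf fz ezw fw; exists w, w'.
exists w1, w2; split=> //; last exact: frontier_separates.
by apply: contraTneq f2 => ->; rewrite fz ltxx.
Qed.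

(** [f] has both signs, so some edge leads from a positive vertex to a
    nonpositive one; the latter is a zero, as the edge lies in a block. *)
Lemma frontier_exists : (exists v, f v != 0) -> exists2 z, f z = 0 & exists2 w, e z w & f w != 0.
Proof.
move=> f0; have [x fx] := exists_positive hf f0.
have [y fy] : exists y, 0 < - f y.
  apply: exists_positive (kernelN hf) _.
  by case: f0 => v fv; exists v; rewrite oppr_eq0.
have [/existsP[u /existsP[v /and3P[euv fu fv]]]|] :=
    boolP [exists u, exists v, [&& e u v, 0 < f u & f v <= 0]].
  exists v; last by exists u; rewrite 1?e_sym // gt_eqF.
  apply/eqP; rewrite eq_le fv leNgt; apply/negP => fv_lt0.
  have [B [blkB uB vB]] := edge_block euv.
  by apply: (@no_mixed B); split=> //; [exists u | exists v].
rewrite negb_exists => /forallP no_edge; suff: 0 < f y by rewrite ltNge ltW // -oppr_gt0.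
apply: (@closed_total (fun v => 0 < f v) x y) => // u v fu euv.
have := no_edge u; rewrite negb_exists => /forallP/(_ v).
by rewrite euv fu /= -ltNge.
Qed.

Lemma case1 : (exists v, f v != 0) -> case1_conclusion e f.
Proof.
move=> f0; have [z fz nbr_z] := frontier_exists f0.
have [w [w' [ezw fw w'z fw' nww']]] := frontier_sides fz nbr_z.
have wz : w != z by apply: contraTneq fw => ->; rewrite fz ltxx.
have pos c v : c != z -> avoid z c v -> 0 < f c -> 0 < f v.
  by move=> cz cv; exact: (component_positive hf fz wz w'z nww' fw fw' cz cv).
have neg c v : c != z -> avoid z c v -> f c < 0 -> f v < 0.
  move=> cz cv; rewrite -!oppr_gt0.
  have nw'w : ~~ avoid z w' w by rewrite avoid_sym.
  apply: (component_positive (kernelN hf) _ w'z wz nw'w _ _ cz cv);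
    by rewrite ?fz ?oppr0 ?oppr_gt0 ?oppr_lt0.
have zero c v : c != z -> avoid z c v -> f c = 0 -> f v = 0.
  move=> cz cv fc; have vc : avoid z v c by rewrite avoid_sym.
  have vz := avoid_neq cv cz.
  have [fv|fv|//] := ltgtP (f v) 0.
    by have := neg v c vz vc fv; rewrite fc ltxx.
  by have := pos v c vz vc fv; rewrite fc ltxx.
exists z; split; [split; first split=> // | split].
- exact: articulationP wz w'z nww'.
- move=> z2 [_ fz2 [w2 ez2 fw2]]; apply/eqP; apply: contraNT fw2 => zz2.
  have [->|w2z] := eqVneq w2 z; first by rewrite fz.
  have z2z : z2 != z by rewrite eq_sym.
  by rewrite (zero z2 w2 z2z (avoid_edge z2z w2z ez2) fz2).
- move=> B blkB; have [->|/set0Pn[c /setD1P[cz cB]]] := eqVneq (B :\ z) set0.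
    by constructor 1 => v; rewrite inE.
  have cv v : v \in B :\ z -> avoid z c v.
    by move=> /setD1P[vz vB]; exact: block_avoid cB vB cz vz.
  have [fc|fc|fc] := ltgtP (f c) 0.
  + by constructor 2 => v /cv zcv; exact: neg zcv fc.
  + by constructor 1 => v /cv zcv; exact: pos zcv fc.
  + by constructor 3 => v /cv zcv; exact: zero zcv fc.
- move=> p pure; have art_z : articulation e z by exact: articulationP wz w'z nww'.
  case: p pure => [|u p] pure; first by constructor 3.
  have [/andP[/= /andP[ezu ep]]] := pure; rewrite -/(uniq (u :: p)) => /andP[zp up] _.
  have uz : u != z by apply: contraNneq zp => ->; rewrite mem_head.
  have uv v : v \in u :: p -> avoid z u v by exact: avoid_mem.
  have zbad v : avoid v z z by exact: avoid_refl.
  have [fu|fu|fu] := ltgtP (f u) 0.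
  + constructor 2; apply: increasing_opp; apply: increasing_along (kernelN hf) pure art_z _ _.
      by move=> v /uv zuv; rewrite oppr_gt0; exact: neg zuv fu.
    by move=> v _; exists z; rewrite ?avoid_refl // fz oppr0.
  + constructor 1; apply: increasing_along hf pure art_z _ _.
      by move=> v /uv zuv; exact: pos zuv fu.
    by move=> v _; exists z; rewrite ?avoid_refl // fz.
  + constructor 3 => a /mapP[v]; rewrite mem_filter => /andP[_ /uv zuv] ->.
    exact: zero zuv fu.
- move=> x p /andP[ep _] [a ap fa] [b bp fb]; apply/negPn/negP => zp.
  have az : a != z by apply: contraNneq zp => <-.
  have ab : avoid z a b.
    by apply: avoid_trans (avoid_mem ep zp bp); rewrite avoid_sym //; exact: avoid_mem ap.
  by have := pos a b az ab fa; rewrite ltNge ltW.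
Qed.
End NoMixed.

(** * A mixed block *)

Section Mixed.
Variable B0 : {set T}.

(** Seen from [z], the whole block [B0] is on the side of [b], which therefore
    contains a negative vertex. *)
Lemma positive_beyond_mixed f z b x : in_kernel f -> mixed_block e f B0 ->
  b \in B0 -> b != z -> x != z -> ~~ avoid z b x -> 0 < f z -> 0 < f x.
Proof.
move=> hf [blk0 _ [a aB fa]] bB bz xz nbx fz.
have az : a != z by apply: contraTneq fa => ->; rewrite -leNgt ltW.
apply: (component_positive_of_sibling hf fz az xz) (ltW fa).
by apply: contra nbx; apply: avoid_trans; exact: block_avoid bB aB bz az.
Qed.

Lemma negative_beyond_mixed f z b x : in_kernel f -> mixed_block e f B0 ->
  b \in B0 -> b != z -> x != z -> ~~ avoid z b x -> f z < 0 -> f x < 0.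
Proof.
move=> hf mix bB bz xz nbx; rewrite -!oppr_gt0.
exact: positive_beyond_mixed (kernelN hf) (mixed_blockN mix) bB bz xz nbx.
Qed.

(** As [f z = 0], the positive and the negative vertex of [B0] differ from [z],
    and both are on the side of [b]. *)
Lemma zero_beyond_mixed f z b x : in_kernel f -> mixed_block e f B0 ->
  b \in B0 -> b != z -> x != z -> ~~ avoid z b x -> f z = 0 -> f x = 0.
Proof.
move=> hf [blk0 [a aB fa] [a' a'B fa']] bB bz xz nbx fz.
have az : a != z by apply: contraTneq fa => ->; rewrite fz ltxx.
have a'z : a' != z by apply: contraTneq fa' => ->; rewrite fz ltxx.
apply: (mixed_component_exclusive hf fz az xz _ _ fa fa').
  exact: block_avoid aB a'B az a'z.
by apply: contra nbx; apply: avoid_trans; exact: block_avoid bB aB bz az.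
Qed.

Lemma other_block_signed f B : in_kernel f -> mixed_block e f B0 -> block e B -> B != B0 ->
  [\/ pos_on f B, neg_on f B | zero_on f B].
Proof.
move=> hf mix blkB BB0; have blk0 : block e B0 by case: mix.
have [b bB0 bB] : exists2 b, b \in B0 & b \notin B.
  apply/subsetPn; apply: contraNN BB0 => sub.
  have /blockP[_ max0] := blk0; have /blockP[biB _] := blkB.
  by rewrite (max0 B biB sub).
have [z zB sep] := block_gate blkB bB.
have bz : b != z by apply: contraNneq bB => ->.
have nbx x : x \in B -> x != z -> ~~ avoid z b x by move=> xB xz; rewrite avoid_sym // sep.
have [fz|fz|fz] := ltgtP (f z) 0.
- constructor 2 => x xB; have [->//|xz] := eqVneq x z.
  exact: negative_beyond_mixed hf mix bB0 bz xz (nbx x xB xz) fz.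
- constructor 1 => x xB; have [->//|xz] := eqVneq x z.
  exact: positive_beyond_mixed hf mix bB0 bz xz (nbx x xB xz) fz.
- constructor 3 => x xB; have [->//|xz] := eqVneq x z.
  exact: zero_beyond_mixed hf mix bB0 bz xz (nbx x xB xz) fz.
Qed.

Lemma mixed_block_unique f B : in_kernel f -> mixed_block e f B0 -> mixed_block e f B -> B0 = B.
Proof.
move=> hf mix0 [blkB [a aB fa] [b bB fb]]; apply/eqP; rewrite eq_sym; apply/negPn/negP => BB0.
case: (other_block_signed hf mix0 blkB BB0) => sgn.
- by have := sgn b bB; rewrite ltNge ltW.
- by have := sgn a aB; rewrite ltNge ltW.
by rewrite (sgn a aB) ltxx in fa.
Qed.

Lemma leaving_path v p : block e B0 -> (exists2 b, b \in B0 & b != v) ->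
  v \in B0 -> gpath e v p -> {in p, forall u, u \notin B0} ->
  exists2 b, b \in B0 & b != v /\ {in p, forall x, x != v /\ ~~ avoid v b x}.
Proof.
move=> blk0 [b bB bv] vB; case: p => [|u p] gp pB; first by exists b.
exists b => //; split=> // x xp; split; first by apply: contraNneq (pB x xp) => ->.
have /andP[/= /andP[evu ep] /andP[vp _]] := gp.
have uB : u \notin B0 by apply: pB; rewrite mem_head.
rewrite avoid_sym //; apply: contra (block_ear blk0 vB uB evu bB bv).
by apply: avoid_trans; exact: avoid_mem xp.
Qed.

Lemma mixed_block_other (f : T -> R) v : mixed_block e f B0 -> exists2 b, b \in B0 & b != v.
Proof.
case=> _ [a aB fa] [b bB fb]; have [av|] := eqVneq a v; last by exists a.
exists b => //; rewrite -av; apply: contraTneq fb => ->.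
by rewrite -leNgt ltW.
Qed.

(** Beyond any vertex of the path, the start [v] is on the same side as the
    negative vertex [a] of [B0], as [increasing_along] requires. *)
Lemma increasing_from_mixed f v p : in_kernel f -> mixed_block e f B0 ->
  pure_path e v p -> v \in B0 -> {in p, forall u, u \notin B0} -> 0 < f v ->
  increasing_seq (art_values e f (v :: p)).
Proof.
move=> hf mix pure vB pB fv; have [blk0 _ [a aB fa]] := mix.
case: p pure pB => [|u p] pure pB.
  by rewrite /increasing_seq /art_values /=; case: ifP.
have gp : gpath e v (u :: p) by case: pure.
have [b bB [bv sep]] := leaving_path blk0 (mixed_block_other v mix) vB gp pB.
have f_gt0 x : x != v -> ~~ avoid v b x -> 0 < f x.
  by move=> xv nbx; exact: positive_beyond_mixed hf mix bB bv xv nbx fv.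
have art_v : articulation e v.
  apply: (@block_articulation B0 v u b) => //; first by apply: pB; rewrite mem_head.
  by case/andP: gp => /andP[].
have inc : increasing_seq (art_values e f (u :: p)).
  apply: (increasing_along hf pure art_v) => x xp; first by have [] := sep x xp; exact: f_gt0.
  exists a; last exact: ltW.
  have xB := pB x xp; by apply: (block_avoid blk0 vB aB); apply: contraNneq xB => <-.
have filter_cons (P : pred T) s : P v -> [seq x <- v :: s | P x] = v :: [seq x <- s | P x].
  by move=> /= ->.
rewrite /increasing_seq /art_values filter_cons // map_cons /sorted (path_sortedE lt_trans).
apply/andP; split; last exact: inc.
apply/allP => _ /mapP[x + ->]; rewrite mem_filter => /andP[_ xp].
have [xv nbx] := sep x xp; apply: (increase_past hf xv) => y xy.
apply: f_gt0; first exact: avoid_neq xy xv.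
by apply: contra nbx => bx; apply: avoid_trans bx _; rewrite avoid_sym.
Qed.

Lemma case2 f : in_kernel f -> mixed_block e f B0 -> case2_conclusion e f B0.
Proof.
move=> hf mix; split; first by move=> B; exact: other_block_signed.
move=> v p pure vB pB; split=> fv.
- exact: increasing_from_mixed.
- apply: increasing_opp; apply: increasing_from_mixed (kernelN hf) (mixed_blockN mix) _ _ _ _ => //.
  by rewrite oppr_gt0.
have [blk0 _ _] := mix; have [gp _] := pure.
have [b bB [bv sep]] := leaving_path blk0 (mixed_block_other v mix) vB gp pB.
have zero : {in v :: p, forall u, f u = 0}.
  move=> x; rewrite in_cons => /orP[/eqP->//|xp]; have [xv nbx] := sep x xp.
  exact: zero_beyond_mixed hf mix bB bv xv nbx fv.
split=> // a /mapP[x]; rewrite mem_filter => /andP[_ xp] ->; exact: zero.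
Qed.
End Mixed.
End Signs.
End Graph.


Theorem theorem2 (R : rcfType) (T : finType) (e : rel T)
    (e_sym : symmetric e) (e_irr : irreflexive e)
    (e_conn : connected_in e [set: T]) (T_ge2 : (2 <= #|T|)%N)
    (lam : R) (lam1 : is_lambda e 1 lam)
    (f : T -> R) (f_harm : harmonic_eigenfunction e lam f) :
  let no_mixed := forall B : {set T}, ~ mixed_block e f B in
  let one_mixed := exists! B0 : {set T}, mixed_block e f B0 in
  [/\ (no_mixed /\ ~ one_mixed) \/ (one_mixed /\ ~ no_mixed),
      no_mixed -> case1_conclusion e f
    & forall B0 : {set T}, mixed_block e f B0 -> case2_conclusion e f B0].
Proof.
move=> no_mixed one_mixed.
have deg_pos v := degree_gt0 e_conn T_ge2 v.
have [lam_gt0 ray] := rayleigh_lambda1 e_sym e_conn e_irr T_ge2 lam1.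
have [f0 hf] := harmonic_eigenfunction_kernel e_conn e_irr T_ge2 f_harm.
split; last 2 first.
- by move=> nm; apply: (case1 e_sym e_conn deg_pos lam_gt0 ray hf nm f0).
- by move=> B0 mix; apply: (case2 e_sym e_conn deg_pos lam_gt0 ray hf mix).
pose mixedb B := [&& block e B, [exists v in B, 0 < f v] & [exists v in B, f v < 0]].
have mixedP B : reflect (mixed_block e f B) (mixedb B).
  by apply: (iffP and3P) => -[blkB /exists_inP ? /exists_inP ?]; split.
have [/existsP[B0 /mixedP mix0]|] := boolP [exists B, mixedb B].
  right; split; last by move=> /(_ B0).
  exists B0; split=> // B mixB.
  exact: (mixed_block_unique e_sym e_conn deg_pos ray hf mix0 mixB).
rewrite negb_exists => /forallP nm; left.
have no_mix : no_mixed by move=> B /mixedP; apply/negP.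
by split=> // -[B0 [mix0 _]]; apply: no_mix mix0.
Qed.
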